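(* Let $1\le i\le n-1$ and let $0<L_0<\lambda^G_i<U_0$ be reals. Define, for $\ell=0,1,2,\dots$, $\lambda_\ell=(L_\ell+U_\ell)/2$ and $$\begin{cases}L_{\ell+1}=L_\ell,\ U_{\ell+1}=\lambda_\ell&\text{if }\xi_{\lambda_\ell}\text{ is of type }j\text{ with }j>i,\text{ or of type }i\text{ with }(-1)^{i-1}\pi(\xi_{\lambda_\ell})>0,\\ U_{\ell+1}=U_\ell,\ L_{\ell+1}=\lambda_\ell&\text{if }\xi_{\lambda_\ell}\text{ is of type }j\text{ with }j<i,\text{ or of type }i\text{ with }(-1)^{i-1}\pi(\xi_{\lambda_\ell})<0,\\ L_{\ell+1}=U_{\ell+1}=\lambda_\ell&\text{if }\xi_{\lambda_\ell}\text{ is of type }i\text{ and }\pi(\xi_{\lambda_\ell})=0.\end{cases}$$ Then $$0\le\max\{U_\ell-\lambda^G_i,\ \lambda^G_i-L_\ell\}\le(U_0-L_0)2^{-\ell},\qquad\forall\ell\ge0.$$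
   Context: Let $n\ge2$, $V=\{1,\dots,n\}$, $E=\{\{i,i+1\}:1\le i\le n-1\}$, $G=(V,E)$. Let $\pi$ be a positive measure on $V$ with $\pi(V)=\sum_i\pi(i)=1$ and $\nu$ a positive measure on $E$ (write $\nu(i,i+1)=\nu(i+1,i)>0$), with the convention $\nu(0,1)=\nu(n,n+1)=0$ (terms multiplied by these coefficients vanish). Put $\pi(f)=\sum_i f(i)\pi(i)$. Let $M^G_{\pi,\nu}$ be the $n\times n$ matrix with entries $M(i,j)=-\nu(i,j)/\pi(i)$ if $|i-j|=1$, $M(i,i)=[\nu(i-1,i)+\nu(i,i+1)]/\pi(i)$, and $0$ otherwise; its eigenvalues are real and simple, $0=\lambda^G_0<\lambda^G_1<\dots<\lambda^G_{n-1}$. For $\lambda\in\mathbb{R}$, $\xi_\lambda:V\to\mathbb{R}$ is defined by $\xi_\lambda(1)=-1$ and, for $1\le k<n$, $\xi_\lambda(k+1)=\xi_\lambda(k)+\frac{[\xi_\lambda(k)-\xi_\lambda(k-1)]\nu(k-1,k)-\lambda\pi(k)\xi_\lambda(k)}{\nu(k,k+1)}$. Type of a function: for $1\le i\le n-1$, a function $f$ on $\{1,\dots,n\}$ is of type $i$ if there are $1=a_1<b_1\le a_2<b_2\le\dots\le a_i<b_i\le n$ with $a_{j+1}-b_j\in\{0,1\}$ such that: $f$ is strictly monotonic on $[a_j,b_j]$ for $1\le j\le i$; $[f(a_j)-f(a_j+1)][f(a_{j+1})-f(a_{j+1}+1)]<0$ for $1\le j<i$; $f(a_{j+1})=f(b_j)$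 for $1\le j<i$; and $f(k)=f(b_i)$ for $b_i\le k\le n$. For $\lambda>0$, $\xi_\lambda$ is of type $j$ for exactly one $j\in\{1,\dots,n-1\}$. *)

(* Defs.v *)
From mathcomp Require Import all_boot all_order all_algebra.
From mathcomp Require Import reals.

Set Implicit Arguments.
Unset Strict Implicit.
Unset Printing Implicit Defensive.

Import Order.TTheory GRing.Theory Num.Theory.
Local Open Scope ring_scope.

(* Vertices are the naturals 1, ..., n; functions on the vertices are functions
   on nat whose values outside {1, ..., n} are irrelevant.  The weight of the
   edge {k, k+1} is nu k, so nu(k-1, k) is nu k.-1. *)

Definition path_entry (R : realType) (pi nu : nat -> R) (i j : nat) : R :=
  if j == i.+1 then - nu i / pi i
  else if i == j.+1 then - nu j / pi i
  else if i == j then (nu i.-1 + nu i) / pi i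
  else 0.

(* Row and column k of the matrix, counted from 0, belong to the vertex k+1. *)
Definition path_mx (R : realType) (n : nat) (pi nu : nat -> R) : 'M[R]_n :=
  \matrix_(i < n, j < n) path_entry pi nu i.+1 j.+1.

Definition mean (R : realType) (n : nat) (pi f : nat -> R) : R :=
  \sum_(1 <= k < n.+1) f k * pi k.

(* The value at 0 is a dummy: in xi 2 it is multiplied by nu 0, which is 0 by
   convention. *)
Fixpoint xi (R : realType) (pi nu : nat -> R) (lam : R) (k : nat) : R :=
  if k is k1.+1 then
    if k1 is k2.+1 then
      xi pi nu lam k1 +
        ((xi pi nu lam k1 - xi pi nu lam k2) * nu k2
           - lam * pi k1 * xi pi nu lam k1) / nu k1
    else -1
  else 0.

Definition strictly_monotonic_on (R : realType) (f : nat -> R) (a b : nat) :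
    Prop :=
  (forall x y : nat, (a <= x)%N -> (x < y)%N -> (y <= b)%N -> f x < f y) \/
  (forall x y : nat, (a <= x)%N -> (x < y)%N -> (y <= b)%N -> f y < f x).

Definition of_type (R : realType) (n : nat) (f : nat -> R) (i : nat) : Prop :=
  (1 <= i <= n.-1)%N /\
  exists a b : nat -> nat,
    [/\ a 1%N = 1%N,
        forall j, (1 <= j <= i)%N -> (a j < b j)%N,
        forall j, (1 <= j < i)%N -> a j.+1 = b j \/ a j.+1 = (b j).+1
      & (b i <= n)%N] /\
    [/\ forall j, (1 <= j <= i)%N -> strictly_monotonic_on f (a j) (b j),
        forall j, (1 <= j < i)%N ->
          (f (a j) - f (a j).+1) * (f (a j.+1) - f (a j.+1).+1) < 0,
        forall j, (1 <= j < i)%N -> f (a j.+1) = f (b j)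
      & forall k, (b i <= k <= n)%N -> f k = f (b i)].

Definition bisection_step (R : realType) (n : nat) (pi nu : nat -> R) (i : nat)
    (L U L' U' : R) : Prop :=
  let m := (L + U) / 2 in
  let f := xi pi nu m in
  let s := (-1) ^+ i.-1 * mean n pi f in
  [/\ (exists2 j, of_type n f j & (i < j)%N) \/ (of_type n f i /\ 0 < s) ->
        L' = L /\ U' = m,
      (exists2 j, of_type n f j & (j < i)%N) \/ (of_type n f i /\ s < 0) ->
        U' = U /\ L' = m
    & of_type n f i /\ mean n pi f = 0 -> L' = m /\ U' = m].

(* Main.v *)
Require Import Defs.
From mathcomp Require Import all_boot all_order all_algebra.
From mathcomp Require Import reals.
From mathcomp Require Import polyrcf.
From mathcomp Require Import ring lra zify.

Set Implicit Arguments.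
Unset Strict Implicit.
Unset Printing Implicit Defensive.

Import Order.TTheory GRing.Theory Num.Theory.
Local Open Scope ring_scope.

(** Multiply the recursion for xi by nu and sum: the flux
    nu(k, k+1) (xi(k+1) - xi(k)) equals x P_(k-1)(x), where
    P_k(x) = - sum_(j <= k+1) pi(j) xi_x(j).  So for x > 0 the values
    P_0(x), ..., P_(n-2)(x) carry the signs of the increments of xi_x, and the
    shape of xi_x is read off from them: each maximal run of increments of one
    sign is a monotone block, and xi_x has type 1 + V, where V is the number of
    sign changes in that list ([of_type_sign_changes]).  One term further,
    P_(n-1)(x) = - pi(xi_x), and x P_(n-1)(x) is the last component of the
    eigenvector equation for xi_x; the eigenvalues of the path are therefore 0
    and the roots of P_(n-1) ([path_eigenvalueE], [path_spectrum]).

    The P_k satisfy a three-term recurrence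
    P_(k+1) = (a_k - b_k X) P_k - c_k P_(k-1) with b_k, c_k > 0, so they form a
    Sturm sequence: P_k has k simple real roots, interlacing those of P_(k+1),
    and the number of roots of P_k below x is the number of sign changes in
    P_0(x), ..., P_k(x) ([sturm_roots]).  The roots of P_(k+1) are produced by
    the intermediate value theorem between those of P_k, where the recurrence
    makes the signs of P_(k+1) alternate.

    Hence the number c of positive eigenvalues below x is V or V + 1, and the
    sign of pi(xi_x) = - P_(n-1)(x) tells which: this is enough to place x with
    respect to lambda_i in every case of the bisection step
    ([bisection_test]).  By induction lambda_i stays in [L_l, U_l], an interval
    whose length is at least halved at each step. *)

(** * Sign changes in sequences without double zeros *)

Section SignChanges.
Variable R : realDomainType.
Implicit Types (u v t : nat -> R) (m : nat).

(** Index k counts when u_k, u_(k+1) have opposite signs, and also when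
    u_k = 0.  In a sequence whose zeros separate values of opposite signs this
    is the classical number of sign changes with zeros discarded: the change
    across an isolated zero is charged to the step that leaves the zero. *)
Definition sign_changes u m : nat :=
  (\sum_(k < m) ((u k == 0%R) || (u k.+1 * u k < 0)%R))%N.

(** The sign pattern of a Sturm sequence at a point: neighbours of an interior
    zero have opposite signs. *)
Definition sturmian u m : Prop :=
  0 < u 0%N /\ forall k, (k.+2 <= m)%N -> u k.+1 = 0 -> u k * u k.+2 < 0.

Lemma sign_changesS u m :
  sign_changes u m.+1 = (sign_changes u m + ((u m == 0%R) || (u m.+1 * u m < 0)%R))%N.
Proof. exact: big_ord_recr. Qed.

Lemma sign_changes_scale t u v m :
  (forall k, (k <= m)%N -> 0 < t k /\ v k = t k * u k) ->
  sign_changes v m = sign_changes u m.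
Proof.
move=> v_tu; apply: eq_bigr => k _.
have [tk ->] := v_tu k (ltnW (ltn_ord k)); have [tk1 ->] := v_tu k.+1 (ltn_ord k).
by rewrite mulf_eq0 gt_eqF //= mulrACA pmulr_rlt0 // mulr_gt0.
Qed.

Lemma sign_changes_gt0 u m :
  (forall k, (k <= m)%N -> 0 < u k) -> sign_changes u m = 0%N.
Proof.
move=> u_gt0; apply: big1 => k _.
have uk : 0 < u k by rewrite u_gt0 // ltnW.
have uk1 : 0 < u k.+1 by rewrite u_gt0.
by rewrite gt_eqF //= ltNge ltW // mulr_gt0.
Qed.

Lemma sturmianW u m p : (p <= m)%N -> sturmian u m -> sturmian u p.
Proof. by move=> pm [u0 uS]; split=> // k kp; apply: uS; apply: leq_trans pm. Qed.

Lemma sturmian_scale t u v m :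
  (forall k, (k <= m)%N -> 0 < t k /\ v k = t k * u k) ->
  sturmian u m -> sturmian v m.
Proof.
move=> v_tu [u0 uS]; split=> [|k km].
  by have [t0 ->] := v_tu 0%N isT; rewrite mulr_gt0.
have [tk1 ->] := v_tu k.+1 (ltnW km).
have [tk2 ->] := v_tu k.+2 km; have [tk ->] := v_tu k (ltnW (ltnW km)).
move/eqP; rewrite mulf_eq0 gt_eqF //= => /eqP uk.
by rewrite mulrACA pmulr_rlt0 ?uS // mulr_gt0.
Qed.

(** The parity of the number of sign changes is the sign of the last nonzero
    term.  When u_m = 0 that term is u_(m-1), since two consecutive zeros cannot
    occur. *)
Lemma last_nonzero_sign u m : sturmian u m ->
  0 < (-1) ^+ sign_changes u m * (if u m == 0 then u m.-1 else u m).
Proof.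
elim: m => [|m IHm] um.
  by rewrite /sign_changes big_ord0 expr0 mul1r; case: um => u0 _; rewrite gt_eqF.
have {IHm} := IHm (sturmianW (leqnSn m) um); rewrite sign_changesS /=.
set s := (-1) ^+ _ => IHm.
case: (eqVneq (u m) 0) IHm => [um0|um0] IHm /=.
  case: m um0 @s um IHm => [|m] um0 s [u0 uS] IHm /=.
    by rewrite um0 ltxx in u0.
  have um2 := uS m (leqnn _) um0.
  case: eqVneq => [um20|_]; first by rewrite um20 mulr0 ltxx in um2.
  have um00 : u m != 0 by apply: contraTneq um2 => ->; rewrite mul0r ltxx.
  have um_sq : 0 < u m ^+ 2 by rewrite exprn_even_gt0.
  rewrite addn1 exprS -/s mulN1r mulNr oppr_gt0 -(pmulr_rlt0 _ um_sq).
  have -> : u m ^+ 2 * (s * u m.+2) = (s * u m) * (u m * u m.+2) by ring.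
  by rewrite pmulr_rlt0.
case: (ltP (u m.+1 * u m) 0) => umS /=.
  case: eqVneq => [um20|um20]; first by rewrite um20 mul0r ltxx in umS.
  rewrite addn1 exprS -/s; nra.
rewrite addn0 -/s; case: eqVneq => // um20.
have : 0 < u m.+1 * u m by rewrite lt_def mulf_neq0.
nra.
Qed.

Lemma sturmian_neq0 u m : sturmian u m.+1 -> u m.+1 = 0 -> u m != 0.
Proof.
move=> um u0; have := last_nonzero_sign um; rewrite u0 eqxx /=.
by apply: contraTneq => ->; rewrite mulr0 ltxx.
Qed.

End SignChanges.


(** * Counting and locating roots *)

Section RootLists.
Variable R : realFieldType.

(** Between two consecutive points of s there is exactly one point of r, so the
    counting functions of interlaced lists differ by at most one. *)
Lemma count_interlaced (r s : seq R) x :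
  sorted <%R r -> sorted <%R s -> size s = (size r).+1 ->
  (forall i, (i < size r)%N -> s`_i < r`_i /\ r`_i < s`_i.+1) ->
  (count (< x) r <= count (< x) s <= (count (< x) r).+1)%N.
Proof.
move=> r_sorted s_sorted size_s rs.
have below_count (q : seq R) i : sorted <%R q -> (i < size q)%N ->
    q`_i < x -> (i < count (< x) q)%N.
  move=> /lt_sorted_is_uniq_le /andP[_ q_sorted] iq; apply: contraTltn => qi.
  by rewrite -leNgt nth_count_ge // qi iq.
have count_below (q : seq R) i : sorted <%R q -> (i < count (< x) q)%N ->
    q`_i < x.
  by move=> /lt_sorted_is_uniq_le /andP[_ ]; apply: nth_count_lt.
have count_r := count_size (< x) r; have count_s := count_size (< x) s.
apply/andP; split.
  case Er: (count _ r) => [|j] //; apply: below_count => //.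
    by move: count_r; rewrite Er size_s => /ltnW.
  apply: lt_trans (_ : r`_j < x); first by apply rs; move: count_r; rewrite Er.
  by apply: count_below => //; rewrite Er.
case Es: (count _ s) => [|[|j]] //; rewrite !ltnS; apply: below_count => //.
  by move: count_s; rewrite Es size_s.
apply: lt_trans (_ : s`_j.+1 < x).
  by apply rs; move: count_s; rewrite Es size_s.
by apply: count_below => //; rewrite Es.
Qed.

Lemma sign_prod_roots (s : seq R) x : x \notin s ->
  0 < (-1) ^+ count (< x) s * ((-1) ^+ size s * \prod_(a <- s) (x - a)).
Proof.
elim: s => [|a s IHs] /=; first by rewrite big_nil !mulr1.
rewrite inE negb_or big_cons => /andP[xa /IHs].
set q := (-1) ^+ count _ _; set e := (-1) ^+ _; set p := \prod_(_ <- _) _ => pos.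
have -> : (-1) ^+ ((a < x)%R + count (< x) s) * ((-1) ^+ (size s).+1 * ((x - a) * p))
   = ((-1) ^+ (a < x)%R * (a - x)) * (q * (e * p)).
  by rewrite exprD exprS -/q -/e; ring.
rewrite mulr_gt0 //; move: xa; rewrite neq_lt => /orP[ax|ax].
  by rewrite (lt_gtF ax) mul1r subr_gt0.
by rewrite ax mulN1r opprB subr_gt0.
Qed.

End RootLists.

(** The intermediate value theorem applied to each gap of a grid on which the
    signs of p alternate. *)
Lemma alternating_roots (R : rcfType) (p : {poly R}) (t : nat -> R) m :
  (forall i, (i < m)%N -> t i < t i.+1) ->
  (forall i, (i <= m)%N -> 0 < (-1) ^+ i * p.[t i]) ->
  exists s : seq R, [/\ size s = m, sorted <%R s, all (root p) s
    & forall i, (i < m)%N -> t i < s`_i < t i.+1].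
Proof.
move=> t_lt t_alt.
have root_between i : {y | (i < m)%N -> t i < y < t i.+1 /\ root p y}.
  case: (ltnP i m) => [im|_]; last by exists 0.
  have [|y] := @poly_ivtoo _ p (t i) (t i.+1) (ltW (t_lt i im)).
    have := t_alt i (ltnW im); have := t_alt i.+1 im; rewrite exprS.
    have [s2] : exists s : R, (-1) ^+ i = s /\ s * s = 1.
      by exists ((-1) ^+ i); rewrite -expr2 sqrr_sign.
    by case=> -> s2E Hi1 Hi; nra.
  by rewrite in_itv /=; exists y.
pose s := mkseq (fun i => sval (root_between i)) m.
have s_nth i : (i < m)%N -> t i < s`_i < t i.+1 /\ root p s`_i.
  by move=> im; rewrite nth_mkseq //; apply: (svalP (root_between i)).
exists s; split; rewrite ?size_mkseq //; last by move=> i /s_nth[].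
  apply/(sortedP 0) => i; rewrite size_mkseq => im.
  have [/andP[_ h1] _] := s_nth i (ltnW im); have [/andP[h2 _] _] := s_nth _ im.
  exact: lt_trans h1 h2.
by apply/(all_nthP 0) => i; rewrite size_mkseq => /s_nth[].
Qed.

(** * Sturm sequences of polynomials *)

Section SturmSequence.
Variables (R : rcfType) (c0 : R) (a b c : nat -> R).

Fixpoint sturm (k : nat) : {poly R} :=
  if k is k1.+1 then
    ((a k1)%:P - b k1 *: 'X) * sturm k1
      - (if k1 is k2.+1 then c k1 *: sturm k2 else 0)
  else c0%:P.

Lemma horner_sturmSS k x : (sturm k.+2).[x] =
  (a k.+1 - b k.+1 * x) * (sturm k.+1).[x] - c k.+1 * (sturm k).[x].
Proof.
have -> : sturm k.+2 =
  ((a k.+1)%:P - b k.+1 *: 'X) * sturm k.+1 - c k.+1 *: sturm k by [].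
by move: (sturm k.+1) (sturm k) => p q; rewrite !hornerE.
Qed.

Variable m : nat.
Hypothesis c0_gt0 : 0 < c0.
Hypothesis b_gt0 : forall k, (k < m)%N -> 0 < b k.
Hypothesis c_gt0 : forall k, (k < m)%N -> 0 < c k.

(** The recurrence at a zero of P_(k+1) reads P_(k+2) = - c P_k; and P_k is
    nonzero there, for otherwise the recurrence would propagate the double zero
    down to the constant P_0 > 0. *)
Lemma sturm_sturmian x : sturmian (fun k => (sturm k).[x]) m.
Proof.
have step k : (k.+2 <= m)%N -> (sturm k.+1).[x] = 0 ->
    (sturm k.+2).[x] = - (c k.+1 * (sturm k).[x]).
  by move=> _ uk; rewrite horner_sturmSS uk mulr0 add0r.
have neq0 k : (k < m)%N -> (sturm k.+1).[x] = 0 -> (sturm k).[x] != 0.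
  elim: k => [|k IHk] km uk; first by rewrite /= hornerC gt_eqF.
  apply/negP => /eqP uk1; have := step k km uk1; rewrite uk => /eqP.
  rewrite eq_sym oppr_eq0 mulf_eq0 gt_eqF ?c_gt0 //= => /eqP uk0.
  by move/eqP: (IHk (ltnW km) uk1).
split=> [|k km uk]; first by rewrite /= hornerC.
rewrite step // mulrN oppr_lt0 mulrCA mulr_gt0 ?c_gt0 //.
by rewrite -expr2 exprn_even_gt0 //= neq0 // ltnW.
Qed.

(** Each step multiplies the leading coefficient by - b_k.  This gives the
    degree and the signs near both infinities. *)
Lemma sturm_size_lead k : (k <= m)%N ->
  size (sturm k) = k.+1 /\ 0 < (-1) ^+ k * lead_coef (sturm k).
Proof.
suff: (k <= m)%N -> [/\ size (sturm k) = k.+1,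
    0 < (-1) ^+ k * lead_coef (sturm k) &
    exists2 q : {poly R}, (size q <= k)%N &
      sturm k.+1 = ((a k)%:P - b k *: 'X) * sturm k - q].
  by move=> H /H[].
elim: k => [|k IHk] km.
  rewrite /= size_polyC lead_coefC mul1r gt_eqF //; split=> //.
  by exists 0; rewrite ?size_poly0.
have [size_k lead_k [q size_q sturmE]] := IHk (ltnW km).
have bk := b_gt0 km.
have sfac : size ((a k)%:P - b k *: 'X) = 2.
  rewrite addrC size_polyDl size_polyN size_scale ?gt_eqF // ?size_polyX //.
  by rewrite (leq_ltn_trans (size_polyC_leq1 _)).
have lfac : lead_coef ((a k)%:P - b k *: 'X) = - b k.
  rewrite addrC lead_coefDl.
    by rewrite lead_coefN lead_coefZ lead_coefX mulr1.
  rewrite size_polyN size_scale ?gt_eqF // ?size_polyX //.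
  by rewrite (leq_ltn_trans (size_polyC_leq1 _)).
have sk0 : sturm k != 0 by rewrite -size_poly_gt0 size_k.
have fac0 : (a k)%:P - b k *: 'X != 0 by rewrite -size_poly_gt0 sfac.
have sprod : size (((a k)%:P - b k *: 'X) * sturm k) = k.+2.
  by rewrite size_mul // sfac size_k.
have small : (size (- q) < size (((a k)%:P - b k *: 'X) * sturm k)%R)%N.
  by rewrite size_polyN sprod ltnS (leq_trans size_q (leqnSn k)).
rewrite sturmE size_polyDl // lead_coefDl // sprod.
rewrite lead_coefM lfac exprS; split=> //.
  by rewrite mulN1r mulNr mulNr mulrN opprK mulrCA mulr_gt0.
exists (c k.+1 *: sturm k); last by rewrite -sturmE.
by rewrite (leq_trans (size_scale_leq _ _)) // size_k.
Qed.

Lemma sturm_gt0_near_minfty k M : (k <= m)%N ->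
  exists2 x, x < M & 0 < (sturm k).[x].
Proof.
move=> /sturm_size_lead[size_k lead_k].
have [|y y_gt] := @poly_pinfty_gt_lc _ (sturm k \Po -'X).
  rewrite lead_coef_comp ?size_polyN ?size_polyX //.
  by rewrite lead_coefN lead_coefX size_k mulrC.
exists (- (Num.max y (1 - M))).
  have : 1 - M <= Num.max y (1 - M) by rewrite le_max lexx orbT.
  lra.
have := y_gt (Num.max y (1 - M)); rewrite le_max lexx /= => /(_ isT).
rewrite horner_comp !hornerE; apply: lt_le_trans.
rewrite lead_coef_comp ?size_polyN ?size_polyX //.
by rewrite lead_coefN lead_coefX size_k mulrC.
Qed.

Lemma sturm_sign_near_pinfty k M : (k <= m)%N ->
  exists2 x, M < x & 0 < (-1) ^+ k * (sturm k).[x].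
Proof.
move=> /sturm_size_lead[size_k lead_k].
have [|y y_gt] := @poly_pinfty_gt_lc _ ((-1) ^+ k *: sturm k).
  by rewrite lead_coefZ.
exists (Num.max y (M + 1)).
  have : M + 1 <= Num.max y (M + 1) by rewrite le_max lexx orbT.
  lra.
have := y_gt (Num.max y (M + 1)); rewrite le_max lexx /= => /(_ isT).
by rewrite hornerZ; apply: lt_le_trans; rewrite lead_coefZ.
Qed.

(** Sturm's root count.  The count for P_k gives, at its i-th root (from 0),
    i sign changes up to P_k and one more up to P_(k+1); hence P_(k+1) alternates along
    the roots of P_k, completed by one point far to the left and one far to the
    right.  This yields k+1 roots of P_(k+1), interlacing those of P_k.  The
    count at k+1 follows because both sides lie in {c, c+1}, with c the count
    at k, and have the same parity, that of the sign of P_(k+1)(x). *)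
Lemma sturm_roots k : (k <= m)%N ->
  exists2 r : seq R,
    [/\ size r = k, sorted <%R r & forall x, root (sturm k) x = (x \in r)] &
    forall x, count (< x) r = sign_changes (fun l => (sturm l).[x]) k.
Proof.
elim: k => [|k IHk] km.
  exists [::] => [|x]; last by rewrite /sign_changes big_ord0.
  by split=> // x; rewrite rootE /= hornerC gt_eqF.
have [r [size_r r_sorted rE] r_count] := IHk (ltnW km).
have u_sturm x := sturmianW km (sturm_sturmian x).
have [t0 t0_lt t0_sign] := sturm_gt0_near_minfty (r`_0) km.
have [t1 t1_gt t1_sign] := sturm_sign_near_pinfty (Num.max t0 (r`_k.-1)) km.
move: t1_gt; rewrite gt_max => /andP[t01 t1_gt].
have r_alt i : (i < k)%N -> 0 < (-1) ^+ i.+1 * (sturm k.+1).[r`_i].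
  move=> ik; have ri : (sturm k).[r`_i] = 0.
    by apply/eqP; rewrite -rootE rE mem_nth // size_r.
  have := last_nonzero_sign (u_sturm r`_i).
  rewrite sign_changesS -r_count count_lt_nth ?size_r // ri eqxx addn1 /=.
  by case: eqVneq => // _; rewrite mulr0 ltxx.
(* The grid: t0, then the roots of P_k, then t1. *)
pose t i := if i is j.+1 then if (j < k)%N then r`_j else t1 else t0.
have t_lt i : (i < k.+1)%N -> t i < t i.+1.
  case: i => [|i] /= ik; first by case: (0 < k)%N.
  have ik' : (i < k)%N by [].
  rewrite ik'; case: ifP => [ik1|ik1]; last by have -> : i = k.-1 by lia.
  by rewrite lt_sorted_ltn_nth // inE size_r.
have t_alt i : (i <= k.+1)%N -> 0 < (-1) ^+ i * (sturm k.+1).[t i].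
  case: i => [|i] ik; first by rewrite mul1r.
  rewrite /t; case: ifP => [/r_alt //|ik1].
  by have -> : i = k by lia.
have [s [size_s s_sorted s_root ts]] := alternating_roots t_lt t_alt.
have [size_p lead_p] := sturm_size_lead km.
have p0 : sturm k.+1 != 0 by rewrite -size_poly_gt0 size_p.
have pE : sturm k.+1 = lead_coef (sturm k.+1) *: \prod_(z <- s) ('X - z%:P).
  apply: all_roots_prod_XsubC => //; first by rewrite size_p size_s.
  by rewrite uniq_rootsE lt_sorted_uniq.
have sE x : root (sturm k.+1) x = (x \in s).
  by rewrite pE rootZ ?lead_coef_eq0 // root_prod_XsubC.
exists s => // x.
have rs i : (i < size r)%N -> s`_i < r`_i /\ r`_i < s`_i.+1.
  rewrite size_r => ik; have := ts i (ltnW ik); have := ts i.+1 ik.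
  by rewrite /= ik => /andP[-> _] /andP[_ ->].
have := count_interlaced x r_sorted s_sorted _ rs.
rewrite size_s size_r => /(_ erefl); rewrite r_count => bounds.
(* At a root s_j of P_(k+1), parity says nothing, but r_(j-1) < s_j does. *)
case: (boolP (root (sturm k.+1) x)) => px.
  have px0 : (sturm k.+1).[x] = 0 by apply/eqP.
  have pk0 := sturmian_neq0 (u_sturm x) px0.
  rewrite sign_changesS px0 mul0r ltxx (negbTE pk0) addn0.
  move: px; rewrite sE => /(nthP 0)[j]; rewrite size_s => jk sj.
  have count_s : count (< x) s = j by rewrite -sj count_lt_nth ?size_s.
  apply/eqP; rewrite eqn_leq; case/andP: bounds => -> _; rewrite andbT count_s.
  rewrite -r_count; case: j jk sj {count_s} => // j jk sj.
  rewrite ltnNge; apply/negP => rj.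
  have /lt_sorted_is_uniq_le /andP[_ r_le] := r_sorted.
  have := @nth_count_ge _ _ x 0 r j r_le; rewrite rj size_r (jk : (j < k)%N) => /(_ isT).
  by rewrite leNgt -sj; have [|_ ->] := rs j; rewrite ?size_r.
have : 0 < (-1) ^+ count (< x) s * (sturm k.+1).[x].
  have := @sign_prod_roots _ s x; rewrite -sE px => /(_ isT).
  rewrite pE hornerZ horner_prod size_s.
  under [X in _ -> 0 < _ * (_ * X)]eq_bigr do rewrite hornerXsubC.
  set C := lead_coef _; set P := \prod_(_ <- _) _; set e := (-1) ^+ count _ _.
  have : (-1) ^+ k.+1 * (-1) ^+ k.+1 = 1 :> R by rewrite -expr2 sqrr_sign.
  move: lead_p; rewrite -/C; set f := (-1) ^+ k.+1 => fC ff efP.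
  have -> : e * (C * P) = (f * C) * (e * (f * P)).
    by rewrite -[LHS]mul1r -ff; ring.
  exact: mulr_gt0.
have := last_nonzero_sign (u_sturm x); rewrite -rootE (negbTE px).
move: bounds; rewrite sign_changesS.
set V := sign_changes _ k; case: (_ || _); rewrite ?addn0 ?addn1.
  have [-> //| /= ne /andP[V1 V2]] := eqVneq (count (< x) s) V.+1.
  have -> : count (< x) s = V.
    by apply/eqP; rewrite eqn_leq V1 andbT -ltnS ltn_neqAle ne V2.
  by rewrite exprS mulN1r mulNr oppr_gt0 => /lt_gtF ->.
have [-> //| /= ne /andP[V1 V2]] := eqVneq (count (< x) s) V.
have -> : count (< x) s = V.+1.
  by apply/eqP; rewrite eqn_leq V2 ltn_neqAle eq_sym ne V1.
by rewrite exprS mulN1r mulNr oppr_gt0 => /lt_gtF ->.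
Qed.

End SturmSequence.

(** * Sign changes of the increments and the type of a function *)

Section Types.

Lemma sign_changes_le (R : realDomainType) (u : nat -> R) m :
  (sign_changes u m <= m)%N.
Proof.
by elim: m => [|m IHm]; rewrite ?sign_changesS /sign_changes ?big_ord0 // -addn1
  leq_add // leq_b1.
Qed.

(** A sequence without double zeros splits into runs [A j, B j) of constant
    sign (-1)^j, separated by at most one zero.  Indices are those of edges, and
    start at 0.  When u_(m+1) is appended it prolongs the last run, opens a new
    one, or is a zero left pending after the last run. *)
Lemma sign_blocks (R : realDomainType) (u : nat -> R) m : sturmian u m ->
  exists A B : nat -> nat, let V := sign_changes u m in
  [/\ A 0%N = 0%N, forall j, (j <= V)%N -> (A j < B j)%N,
      forall j, (j < V)%N ->
        A j.+1 = B j \/ (A j.+1 = (B j).+1 /\ u (B j) = 0),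
      forall j e, (j <= V)%N -> (A j <= e < B j)%N -> 0 < (-1) ^+ j * u e
    & B V = m.+1 \/ (B V = m /\ u m = 0)].
Proof.
elim: m => [|m IHm] um.
  exists (fun=> 0%N), (fun=> 1%N); rewrite /sign_changes big_ord0.
  split=> // [j e|]; last by left.
  by case: um; case: j => //; case: e => // *; rewrite mul1r.
have [A [B /= [A0 AB Anext AB_sign B_last]]] := IHm (sturmianW (leqnSn m) um).
have := last_nonzero_sign um; have := @sturmian_neq0 _ u m um.
rewrite sign_changesS.
move: AB Anext AB_sign B_last; set V := sign_changes u m => AB Anext AB_sign B_last.
case: (boolP (_ || _)) => [change|]; last first.
  rewrite negb_or addn0 -leNgt /= => /andP[um0 umS] _ last_sign.
  have {}B_last : B V = m.+1 by case: B_last um0 => // -[_ ->]; rewrite eqxx.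
  have Vm : 0 < (-1) ^+ V * u m.
    by apply: AB_sign => //; have := AB V (leqnn _); rewrite B_last ltnS => ->/=.
  have [umS0|umS0] := eqVneq (u m.+1) 0.
    by exists A, B; split=> //; right.
  exists A, (fun j => if j == V then m.+2 else B j); rewrite eqxx.
  split=> //; last by left.
  - move=> j jV; case: eqP => [->|_]; last exact: AB.
    by apply: leq_trans (AB V _) _; rewrite // B_last.
  - by move=> j jV; rewrite ltn_eqF //; apply: Anext.
  - move=> j e jV; case: eqP => [->|_]; last exact: AB_sign.
    rewrite ltnS => /andP[Ve]; rewrite leq_eqVlt => /orP[/eqP ->|em].
      by move: last_sign; rewrite (negbTE umS0).
    by apply: AB_sign; rewrite // Ve B_last.
rewrite addn1 => umS0_um last_sign.
have umS0 : u m.+1 != 0.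
  by apply: contraTneq change => umS0; rewrite umS0 mul0r ltxx orbF umS0_um.
exists (fun j => if j == V.+1 then m.+1 else A j).
exists (fun j => if j == V.+1 then m.+2 else B j); rewrite eqxx.
split=> //; last by left.
- move=> j jV; case: eqP => // /eqP ne; apply: AB.
  by rewrite -ltnS ltn_neqAle ne jV.
- move=> j jV; rewrite (ltn_eqF jV) eqSS; case: eqP => [->|/eqP ne].
    by case: B_last => [->|[-> um0]]; [left|right].
  by apply: Anext; rewrite ltn_neqAle ne.
- move=> j e jV; case: eqP => [->|/eqP ne] eAB; last first.
    by apply: AB_sign => //; rewrite -ltnS ltn_neqAle ne jV.
  have -> : e = m.+1 by apply/eqP; rewrite eqn_leq andbC.
  by move: last_sign; rewrite (negbTE umS0).
Qed.

Lemma increasing_from_steps (R : realDomainType) (f : nat -> R) a b :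
  (forall e, (a <= e < b)%N -> f e < f e.+1) ->
  forall x y, (a <= x)%N -> (x < y)%N -> (y <= b)%N -> f x < f y.
Proof.
move=> f_step x y ax xy; rewrite -(subnKC xy).
elim: (y - x.+1)%N => [|d IHd]; first by rewrite addn0 => xb; apply: f_step; rewrite ax.
rewrite addnS => db; apply: lt_trans (IHd (ltnW db)) _; apply: f_step.
by rewrite db andbT (leq_trans ax) // (leq_trans (leqnSn x)) // leq_addr.
Qed.

(** The runs of constant sign of the increments are the monotone blocks of f.
    Since of_type counts vertices and blocks from 1, both indices are shifted. *)
Lemma of_type_sign_changes (R : realType) (f : nat -> R) m :
  sturmian (fun k => f k.+2 - f k.+1) m ->
  of_type m.+2 f (sign_changes (fun k => f k.+2 - f k.+1) m).+1.
Proof.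
set u := fun k : nat => _ => um; split.
  by apply/andP; split=> //; apply: sign_changes_le.
have [A [B /=]] := sign_blocks um; set V := sign_changes u m.
move=> [A0 AB Anext AB_sign B_last].
have A_sign j : (j <= V)%N -> 0 < (-1) ^+ j * u (A j).
  by move=> jV; apply: AB_sign => //; rewrite leqnn AB.
exists (fun j => (A j.-1).+1), (fun j => (B j.-1).+1); split; split.
- by rewrite A0.
- by case=> // j jV; rewrite ltnS; apply: AB.
- case=> // j jV /=; case: (Anext j jV) => [->|[-> _]]; [by left|by right].
- by case: B_last => [->|[-> _]].
- case=> // j jV /=.
  have steps e : ((A j).+1 <= e < (B j).+1)%N -> 0 < (-1) ^+ j * (f e.+1 - f e).
    by case: e => // e eAB; apply: AB_sign.
  move: steps; case: (boolP (odd j)) => odd_j steps.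
    right=> x y ax xy yb; rewrite -ltrN2.
    apply: (@increasing_from_steps _ (fun k => - f k) _ _ _ _ _ ax xy yb) => e.
    move=> /steps; rewrite -signr_odd odd_j mulN1r oppr_gt0 subr_lt0.
    by rewrite ltrN2.
  left; apply: increasing_from_steps => e /steps.
  by rewrite -signr_odd (negbTE odd_j) mul1r subr_gt0.
- case=> // j /andP[_]; rewrite ltnS => jV /=.
  have := A_sign _ jV; have := A_sign _ (ltnW jV).
  rewrite -[f (A j).+1 - _]opprB -[f (A j.+1).+1 - _]opprB mulrNN.
  rewrite -/(u (A j)) -/(u (A j.+1)) exprS mulN1r mulNr oppr_gt0 => h1 h2.
  by move: h2; rewrite -(pmulr_rlt0 _ h1) mulrACA -expr2 sqrr_sign mul1r.
- case=> // j jV /=; case: (Anext j jV) => [->|[-> uB]] //.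
  by apply/eqP; rewrite -subr_eq0; apply/eqP.
- move=> k /= /andP[]; case: B_last => [->|[-> um0]].
    by move=> k1 k2; have -> : k = m.+2 by apply/eqP; rewrite eqn_leq k2.
  rewrite leq_eqVlt => /orP[/eqP<- //|k1] k2.
  have -> : k = m.+2 by apply/eqP; rewrite eqn_leq k2.
  by apply/eqP; rewrite -subr_eq0; apply/eqP.
Qed.

End Types.

(** * The eigenvalues of the path *)

Section PathSpectrum.
Variables (R : realType) (n : nat) (pi nu : nat -> R).
Hypothesis n_ge2 : (2 <= n)%N.
Hypothesis pi_gt0 : forall k, (1 <= k <= n)%N -> 0 < pi k.
Hypothesis nu_gt0 : forall k, (1 <= k <= n.-1)%N -> 0 < nu k.
Hypothesis nu_0 : nu 0%N = 0.
Hypothesis nu_n : nu n = 0.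

Lemma meanS k f : mean k.+1 pi f = mean k pi f + f k.+1 * pi k.+1.
Proof. by rewrite /mean big_nat_recr. Qed.

Lemma mean0 f : mean 0 pi f = 0.
Proof. by rewrite /mean big_geq. Qed.

Lemma nu_neq0 k : (0 < k)%N -> (k < n)%N -> nu k != 0.
Proof. by move=> k0 kn; rewrite gt_eqF // nu_gt0 // k0; case: n kn. Qed.

Lemma pi_neq0 k : (k < n)%N -> pi k.+1 != 0.
Proof. by move=> kn; rewrite gt_eqF // pi_gt0. Qed.

(** The defining recursion of xi, summed from the left end. *)
Lemma flux_xi x k : (k < n)%N ->
  nu k * (xi pi nu x k.+1 - xi pi nu x k) = - x * mean k pi (xi pi nu x).
Proof.
elim: k => [|k IHk] kn; first by rewrite mean0 nu_0 mul0r mulr0.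
have := IHk (ltnW kn); rewrite meanS => flux_k.
have -> : xi pi nu x k.+2 = xi pi nu x k.+1 + ((xi pi nu x k.+1 - xi pi nu x k) * nu k
  - x * pi k.+1 * xi pi nu x k.+1) / nu k.+1 by [].
have nuk := nu_neq0 (ltn0Sn k) kn.
rewrite addrC addKr mulrC divfK // [_ * nu k]mulrC flux_k; ring.
Qed.

(** At x, the k-th polynomial is the flux of xi_x through the edge
    {k+1, k+2}, divided by x; the last one, at k = n-1, is what would flow out
    of the right end. *)
Definition flux_poly : nat -> {poly R} :=
  sturm (pi 1%N) (fun k => 1 + pi k.+2 / pi k.+1)
    (fun k => pi k.+2 / nu k.+1) (fun k => pi k.+2 / pi k.+1).

(** Eliminate xi between mean(k+1) - mean(k) = xi(k+1) pi(k+1) and the flux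
    identity: the partial means satisfy the three-term recurrence. *)
Lemma flux_polyE x k : (k < n)%N ->
  (flux_poly k).[x] = - mean k.+1 pi (xi pi nu x).
Proof.
suff: (k < n)%N -> (flux_poly k).[x] = - mean k.+1 pi (xi pi nu x) /\
    ((k.+1 < n)%N -> (flux_poly k.+1).[x] = - mean k.+2 pi (xi pi nu x)).
  by move=> H /H[].
have xiSS l : (l.+1 < n)%N -> xi pi nu x l.+2 =
    xi pi nu x l.+1 - x * mean l.+1 pi (xi pi nu x) / nu l.+1.
  move=> ln; have nul := nu_neq0 (ltn0Sn l) ln; have := flux_xi x ln.
  set d := mean _ _ _ => flux; apply: (mulfI nul).
  rewrite mulrBr [nu _ * (_ / _)]mulrC divfK // -[X in _ = _ - X]opprK -mulNr -flux.
  ring.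
elim: k => [|k IHk] kn.
  have m1 : mean 1 pi (xi pi nu x) = - pi 1%N.
    by rewrite meanS mean0 add0r /= mulN1r.
  split=> [|n1]; first by rewrite /= hornerC m1 opprK.
  rewrite meanS xiSS // m1 /= subr0 !hornerE.
  have := pi_neq0 kn; have := nu_neq0 (ltn0Sn 0) n1; move=> nu1 pi1.
  by field; rewrite nu1 pi1.
have [IHk0 IHk1] := IHk (ltnW kn); split=> [|kn2]; first exact: IHk1.
rewrite [LHS]horner_sturmSS -/flux_poly IHk0 IHk1 //.
rewrite (meanS k.+2) xiSS // (meanS k.+1).
have := pi_neq0 kn; have := nu_neq0 (ltn0Sn k.+1) kn2; move=> nu2 pi2.
by field; rewrite nu2 pi2.
Qed.

(** The matrix acts on rows, where it is symmetrized by the weight pi: on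
    pi * w it returns the divergence of the flux of w.  The two boundary fluxes
    vanish because nu 0 = nu n = 0. *)
Lemma row_mul_path_mx (w : nat -> R) (j : 'I_n) :
  ((\row_(i < n) (pi i.+1 * w i.+1)) *m path_mx n pi nu) ord0 j =
  nu j * (w j.+1 - w j) - nu j.+1 * (w j.+2 - w j.+1).
Proof.
rewrite mxE.
have entryE (i : 'I_n) : (\row_(i < n) (pi i.+1 * w i.+1)) ord0 i * path_mx n pi nu i j =
   (if i.+1 == j then - nu i.+1 * w i.+1 else 0) +
   (if i == j.+1 :> nat then - nu i * w i.+1 else 0) +
   (if i == j :> nat then (nu i + nu i.+1) * w i.+1 else 0).
  have pi_i : pi i.+1 != 0 by rewrite pi_neq0.
  rewrite !mxE /path_entry !eqSS [(j : nat) == _]eq_sym.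
  case: eqP => [ij|nij].
    by rewrite !ifF; [field| apply/eqP; lia| apply/eqP; lia].
  case: eqP => [ij|nij2].
    by rewrite ifF; [rewrite ij; field; rewrite -ij| apply/eqP; lia].
  by case: eqP => [_|nij3] /=; [field|ring].
under eq_bigr do rewrite entryE.
rewrite !big_split /= -!big_mkcond /=.
rewrite (big_ord1_eq _ (fun i => - nu i * w i.+1)).
rewrite (big_ord1_eq _ (fun i => (nu i + nu i.+1) * w i.+1)) ltn_ord.
have -> : \sum_(i < n | i.+1 == j) - nu i.+1 * w i.+1 = - nu j * w j.
  case: j {entryE} => [[|j] jn] /=; first by rewrite big_pred0 // nu_0 oppr0 mul0r.
  by under eq_bigl do rewrite eqSS; rewrite (big_ord1_eq _ (fun i => - nu i.+1 * w i.+1)) ltnW.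
case: ifP => [_|/negbT]; first by ring.
rewrite -leqNgt => nj; have -> : j.+1 = n by apply/eqP; rewrite eqn_leq ltn_ord.
by rewrite nu_n; ring.
Qed.

(** Write a left eigenvector as pi * w.  Summed from the left, the equation
    determines w from w 1 and forces w = - w 1 * xi_x; the only remaining
    condition is at the right end, where the flux vanishes. *)
Lemma path_eigenvalueE x :
  eigenvalue (path_mx n pi nu) x = (x * mean n pi (xi pi nu x) == 0).
Proof.
have n_gt0 : (0 < n)%N by apply: leq_trans n_ge2.
apply/eigenvalueP/eqP => [[v vM v0]|x_mean].
  pose w k := oapp (fun j : 'I_n => v ord0 j) 0 (insub k.-1) / pi k.
  have wE (j : 'I_n) : v ord0 j = pi j.+1 * w j.+1.
    by rewrite /w /= valK /= mulrC divfK // pi_neq0.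
  have vE : v = \row_(i < n) (pi i.+1 * w i.+1).
    by apply/rowP => j; rewrite mxE wE.
  have flux k : (k <= n)%N -> nu k * (w k.+1 - w k) = - x * mean k pi w.
    elim: k => [|k IHk] kn; first by rewrite mean0 nu_0 mul0r mulr0.
    have := row_mul_path_mx w (Ordinal kn); rewrite -vE vM mxE wE /=.
    rewrite IHk ?(ltnW kn) // meanS => eq_k.
    apply/eqP; rewrite -subr_eq0; apply/eqP.
    transitivity (x * (pi k.+1 * w k.+1) -
      (- x * mean k pi w - nu k.+1 * (w k.+2 - w k.+1))); first by ring.
    by rewrite -eq_k subrr.
  have w_xi k : (k <= n)%N -> forall l, (0 < l <= k)%N -> w l = - w 1%N * xi pi nu x l.
    elim: k => [|k IHk] kn l; first by case: l.
    move=> /andP[l0]; rewrite leq_eqVlt => /orP[/eqP lk|lk]; last first.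
      by apply: (IHk (ltnW kn)); rewrite l0.
    case: k lk IHk kn => [|k] -> IHk kn; first by rewrite /= mulrN1 opprK.
    have means : mean k.+1 pi w = - w 1%N * mean k.+1 pi (xi pi nu x).
      rewrite /mean mulr_sumr; apply: eq_big_nat => e ek.
      by rewrite (IHk (ltnW kn)) // mulrA.
    have := flux k.+1 (ltnW kn).
    rewrite means mulrCA -(flux_xi x kn) mulrCA => /(mulfI (nu_neq0 (ltn0Sn k) kn)).
    rewrite (IHk (ltnW kn) k.+1) ?leqnn // mulrBr => /eqP.
    by rewrite subr_eq subrK => /eqP.
  have w1 : w 1%N != 0.
    apply: contraNneq v0 => w1; apply/eqP/rowP => j.
    by rewrite wE (w_xi n (leqnn n) j.+1 (ltn_ord j)) w1 oppr0 mul0r mulr0 mxE.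
  have := flux n (leqnn n); rewrite nu_n mul0r.
  have -> : mean n pi w = - w 1%N * mean n pi (xi pi nu x).
    rewrite /mean mulr_sumr; apply: eq_big_nat => e en.
    by rewrite (w_xi n) // mulrA.
  move=> /esym/eqP; rewrite mulrCA mulf_eq0 oppr_eq0 (negbTE w1) /=.
  by rewrite mulNr oppr_eq0 => /eqP.
exists (\row_(i < n) (pi i.+1 * xi pi nu x i.+1)).
  apply/rowP => j; rewrite row_mul_path_mx mxE mxE flux_xi //.
  have -> : nu j.+1 * (xi pi nu x j.+2 - xi pi nu x j.+1) =
      - x * mean j.+1 pi (xi pi nu x).
    have [jn|nj] := ltnP j.+1 n; first exact: flux_xi.
    have -> : j.+1 = n by apply/eqP; rewrite eqn_leq ltn_ord.
    by rewrite nu_n mul0r mulNr x_mean oppr0.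
  by rewrite meanS; ring.
apply/eqP => /rowP/(_ (Ordinal n_gt0)); rewrite !mxE /= mulrN1 => /eqP.
by rewrite oppr_eq0 (negbTE (pi_neq0 n_gt0)).
Qed.

End PathSpectrum.

(** * The bisection *)

Section Bisection.
Variables (R : realType) (n : nat) (pi nu : nat -> R).
Hypothesis n_ge2 : (2 <= n)%N.
Hypothesis pi_gt0 : forall k, (1 <= k <= n)%N -> 0 < pi k.
Hypothesis nu_gt0 : forall k, (1 <= k <= n.-1)%N -> 0 < nu k.
Hypothesis nu_0 : nu 0%N = 0.
Hypothesis nu_n : nu n = 0.

Local Notation P := (flux_poly pi nu).
Local Notation u x := (fun k => (P k).[x]).
Local Notation mean_xi x := (mean n pi (xi pi nu x)).

Lemma flux_coef_gt0 k : (k < n.-1)%N ->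
  [/\ 0 < pi k.+1, 0 < pi k.+2 & 0 < nu k.+1].
Proof.
by move=> kn; split; [apply: pi_gt0 | apply: pi_gt0 | apply: nu_gt0]; lia.
Qed.

Lemma flux_poly_last x : (P n.-1).[x] = - mean_xi x.
Proof. by rewrite (flux_polyE pi_gt0 nu_gt0 nu_0) prednK //; lia. Qed.

Lemma flux_sturmian x : sturmian (u x) n.-1.
Proof.
apply: sturm_sturmian => [|k kn]; first by apply: pi_gt0; lia.
by have [pk pk1 _] := flux_coef_gt0 kn; apply: divr_gt0.
Qed.

Lemma flux_roots : exists2 r : seq R,
    [/\ size r = n.-1, sorted <%R r & forall x, (x \in r) = (mean_xi x == 0)] &
    forall x, count (< x) r = sign_changes (u x) n.-1.
Proof.
have [|k kn|k kn|r [size_r r_sorted rE] r_count] := @sturm_roots R (pi 1%N)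
    (fun k => 1 + pi k.+2 / pi k.+1) (fun k => pi k.+2 / nu k.+1)
    (fun k => pi k.+2 / pi k.+1) n.-1 _ _ _ n.-1 (leqnn _).
- by apply: pi_gt0; lia.
- by have [_ pk nuk] := flux_coef_gt0 kn; apply: divr_gt0.
- by have [pk pk1 _] := flux_coef_gt0 kn; apply: divr_gt0.
exists r => //; split=> // x.
by rewrite -rE rootE -/(flux_poly pi nu) flux_poly_last oppr_eq0.
Qed.

(** At x = 0, xi is constantly -1 and every P_k(0) is a partial sum of pi: no
    sign change occurs, so P_(n-1) has no root below or at 0, and putting 0 in
    front of its roots gives the sorted spectrum. *)
Lemma path_spectrum (lam : seq R) :
  sorted <%R lam -> lam =i eigenvalue (path_mx n pi nu) ->
  exists2 r : seq R,
    [/\ lam = 0 :: r, size r = n.-1, sorted <%R r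
      & forall x, (x \in r) = (mean_xi x == 0)] &
    forall x, count (< x) r = sign_changes (u x) n.-1.
Proof.
move=> lam_sorted lam_eigen; have [r [size_r r_sorted rE] r_count] := flux_roots.
exists r => //; split=> //; apply: lt_sorted_eq => // [|x]; last first.
  by rewrite lam_eigen [LHS](path_eigenvalueE n_ge2) // mulf_eq0 inE rE.
rewrite /= lt_path_sortedE r_sorted andbT; apply/allP => y yr.
have flux0_gt0 k : (k <= n.-1)%N -> 0 < (P k).[0].
  move=> kn; rewrite (flux_polyE pi_gt0 nu_gt0 nu_0); last by lia.
  have xi0 l : (l < n)%N -> xi pi nu 0 l.+1 = -1.
    elim: l => // l IHl ln; have := flux_xi pi nu_gt0 nu_0 0 ln.
    rewrite oppr0 mul0r => /eqP; rewrite mulf_eq0 IHl ?(ltnW ln) //.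
    by rewrite (negbTE (nu_neq0 nu_gt0 _ ln)) //= subr_eq0 => /eqP.
  have mean_le0 l : (l <= n)%N -> mean l pi (xi pi nu 0) <= 0.
    elim: l => [|l IHl] ln; first by rewrite mean0.
    rewrite meanS xi0 // mulN1r subr_le0 (le_trans (IHl (ltnW ln))) // ltW //.
    exact: pi_gt0.
  have kn' : (k < n)%N by lia.
  rewrite meanS xi0 // mulN1r opprD opprK ltr_wpDl ?pi_gt0 // oppr_ge0.
  by apply: mean_le0; apply: ltnW.
have y0 : y != 0.
  apply: contraTneq yr => ->; rewrite rE -oppr_eq0 -flux_poly_last.
  by rewrite gt_eqF // flux0_gt0.
rewrite lt_neqAle eq_sym y0 leNgt; apply/negP => y_neg.
have := r_count 0; rewrite sign_changes_gt0 // => /eqP.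
by rewrite -leqn0 leqNgt -has_count => /hasP[]; exists y.
Qed.

(** For x > 0 the increments of xi_x are positive multiples of the P_k(x). *)
Lemma xi_of_type x : 0 < x ->
  of_type n (xi pi nu x) (sign_changes (u x) n.-2).+1.
Proof.
move=> x_gt0; pose d k := xi pi nu x k.+2 - xi pi nu x k.+1.
have d_flux k : (k <= n.-2)%N -> 0 < x / nu k.+1 /\ d k = x / nu k.+1 * (P k).[x].
  move=> kn; have kn1 : (k < n.-1)%N by lia.
  have [_ _ nuk] := flux_coef_gt0 kn1; split; first exact: divr_gt0.
  apply: (mulfI (lt0r_neq0 nuk)).
  rewrite (flux_xi pi nu_gt0 nu_0); last by lia.
  rewrite (flux_polyE pi_gt0 nu_gt0 nu_0); last by lia.
  by field; rewrite gt_eqF.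
rewrite -(sign_changes_scale d_flux).
have n2 : n = n.-2.+2 by lia.
rewrite [X in of_type X]n2; apply: of_type_sign_changes.
apply: sturmian_scale d_flux _.
by apply: sturmianW (flux_sturmian x); lia.
Qed.

(** Let V = j - 1 be the number of sign changes up to P_(n-2)(x).  The number c
    of roots of P_(n-1) below x is V or V + 1, which settles j <> i+1.  If
    j = i + 1, then V = i, and c is decided by the sign of P_(n-1)(x), which is
    (-1)^c when it is nonzero; if P_(n-1)(x) = 0, then c = V. *)
Lemma bisection_test (r : seq R) i x :
  size r = n.-1 -> sorted <%R r -> (forall x, (x \in r) = (mean_xi x == 0)) ->
  (forall x, count (< x) r = sign_changes (u x) n.-1) ->
  (i < n.-1)%N -> 0 < x ->
  exists2 j, of_type n (xi pi nu x) j &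
    [/\ (i.+1 < j)%N -> r`_i <= x, (j < i.+1)%N -> x <= r`_i
      & j = i.+1 -> [/\ 0 < (-1) ^+ i * mean_xi x -> r`_i <= x,
                        (-1) ^+ i * mean_xi x < 0 -> x <= r`_i
                      & mean_xi x = 0 -> x = r`_i]].
Proof.
move=> size_r r_sorted rE r_count ir x_gt0.
exists (sign_changes (u x) n.-2).+1; first exact: xi_of_type.
have n1 : n.-1 = n.-2.+1 by lia.
have below : (i < count (< x) r)%N -> r`_i <= x.
  move=> ic; apply/ltW; apply: nth_count_lt => //.
  by case/lt_sorted_is_uniq_le/andP: r_sorted.
have above : (count (< x) r <= i)%N -> x <= r`_i.
  move=> ic; apply: nth_count_ge; last by rewrite ic size_r.
  by case/lt_sorted_is_uniq_le/andP: r_sorted.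
have u_sturm := flux_sturmian x; have sign_last := last_nonzero_sign u_sturm.
have cS := r_count x; rewrite n1 sign_changesS -n1 in cS.
move: sign_last; rewrite -r_count flux_poly_last oppr_eq0 => sign_last.
set V := sign_changes (u x) n.-2 in cS *.
have count_bounds : (V <= count (< x) r <= V.+1)%N.
  by rewrite cS leq_addr -addn1 leq_add2l leq_b1.
rewrite !ltnS; split.
- by move=> iV; apply: below; apply: leq_trans iV _; case/andP: count_bounds.
- by move=> Vi; apply: above; case/andP: count_bounds => _ /leq_trans; apply.
case=> V_i; rewrite V_i in cS count_bounds; split.
- move=> s_gt0; apply: below; rewrite ltn_neqAle; case/andP: count_bounds => -> _.
  rewrite andbT; apply: contraTneq sign_last => <-; rewrite ifN.
    by rewrite mulrN -leNgt oppr_le0 ltW.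
  by apply: contraTneq s_gt0 => ->; rewrite mulr0 ltxx.
- move=> s_lt0; apply: above; rewrite -ltnS ltn_neqAle; case/andP: count_bounds => _ ->.
  rewrite andbT; apply: contraTneq sign_last => ->; rewrite ifN.
    by rewrite exprS mulN1r mulrNN -leNgt ltW.
  by apply: contraTneq s_lt0 => ->; rewrite mulr0 ltxx.
move=> mean_x0; have : x \in r by rewrite rE mean_x0 eqxx.
have u0 : (P n.-1).[x] = 0 by rewrite flux_poly_last mean_x0 oppr0.
have u1 : (P n.-2).[x] != 0.
  by move: u_sturm u0; rewrite n1; apply: sturmian_neq0.
move: cS; rewrite u0 mul0r ltxx (negbTE u1) addn0 => cS.
move=> /(nthP 0)[l lr xl]; rewrite -xl; congr (r`_ _).
by rewrite -cS -xl count_lt_nth.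
Qed.

End Bisection.

Theorem theorem3p4 (R : realType) (n : nat) (hn : (2 <= n)%N)
  (pi nu : nat -> R)
  (pi_gt0 : forall k, (1 <= k <= n)%N -> 0 < pi k)
  (pi_sum : \sum_(1 <= k < n.+1) pi k = 1)
  (nu_gt0 : forall k, (1 <= k <= n.-1)%N -> 0 < nu k)
  (nu_0 : nu 0%N = 0) (nu_n : nu n = 0)
  (lam : seq R)
  (lam_sorted : sorted <%R lam)
  (lam_eigen : lam =i eigenvalue (path_mx n pi nu))
  (i : nat) (hi : (1 <= i <= n.-1)%N)
  (L U : nat -> R)
  (L0_gt0 : 0 < L 0%N) (L0_lt : L 0%N < lam`_i) (U0_gt : lam`_i < U 0%N)
  (LU_step : forall l : nat,
     bisection_step n pi nu i (L l) (U l) (L l.+1) (U l.+1)) :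
  forall l : nat,
    0 <= Num.max (U l - lam`_i) (lam`_i - L l) <= (U 0%N - L 0%N) * 2 ^- l.
Proof.
have [r [lamE size_r r_sorted rE] r_count] :=
  path_spectrum hn pi_gt0 nu_gt0 nu_0 nu_n lam_sorted lam_eigen.
case: i hi L0_lt U0_gt LU_step => // i /andP[_ ir].
rewrite lamE /= => L0_lt U0_gt LU_step l.
suff [_ Lr rU width] : [/\ 0 < L l, L l <= r`_i, r`_i <= U l
    & U l - L l <= (U 0%N - L 0%N) * 2 ^- l].
  rewrite le_max ge_max subr_ge0 rU /=; apply/andP; split; lra.
elim: l => [|l [L_gt0 Lr rU width]].
  by split=> //; rewrite ?expr0 ?invr1 ?mulr1 // ltW.
have x_gt0 : 0 < (L l + U l) / 2 by lra.
have [j j_type] := bisection_test hn pi_gt0 nu_gt0 nu_0 size_r r_sorted rE r_count ir x_gt0.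
have := LU_step l; rewrite /bisection_step /=.
set x := (L l + U l) / 2 in x_gt0 j_type *; move=> [high low hit] [j_gt j_lt j_eq].
have half : 2 ^- l.+1 = 2 ^- l / 2 :> R by rewrite exprS invfM mulrC.
have x2 : x * 2 = L l + U l by rewrite /x divfK // pnatr_eq0.
rewrite half; set w := 2 ^- l in width *; set D := U 0%N - L 0%N in width *.
have D2 : D * (w / 2) * 2 = D * w by rewrite mulrA divfK // pnatr_eq0.
have [ji|ij|ji] := ltngtP j i.+1.
- have [-> ->] := low (or_introl (ex_intro2 _ _ j j_type ji)).
  by have := j_lt ji; split; lra.
- have [-> ->] := high (or_introl (ex_intro2 _ _ j j_type ij)).
  by have := j_gt ij; split; lra.
rewrite ji in j_type; have [s_gt s_lt s_eq] := j_eq ji.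
have [s|s|s] := ltrgtP ((-1) ^+ i * mean n pi (xi pi nu x)) 0.
- have [-> ->] := low (or_intror (conj j_type s)).
  by have := s_lt s; split; lra.
- have [-> ->] := high (or_intror (conj j_type s)).
  by have := s_gt s; split; lra.
have mean_0 : mean n pi (xi pi nu x) = 0.
  by apply/eqP; move/eqP: s; rewrite mulf_eq0 signr_eq0.
have [-> ->] := hit (conj j_type mean_0).
by have := s_eq mean_0; split; lra.
Qed.
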